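(* Let $H$ be a shortest path graph that contains an induced cycle $C_k$ for some odd $k>3$. Then $H$ contains an induced $C_4$.
   Context: Graphs are finite and simple. $C_k$ denotes the cycle on $k$ vertices. For a graph $G$ with distinct vertices $a,b$, a shortest $a,b$-path is a path between $a$ and $b$ of length $d_G(a,b)$. The shortest path graph $S(G,a,b)$ is the graph whose vertices are the shortest $a,b$-paths in $G$, two of them being adjacent if and only if the corresponding paths differ in exactly one vertex. A graph $H$ is called a shortest path graph if there exist a graph $G$ and distinct $a,b\in V(G)$ with $S(G,a,b)\cong H$. *)

(* Defs.v *)
From mathcomp Require Import all_boot.

Set Implicit Arguments.
Unset Strict Implicit.
Unset Printing Implicit Defensive.

Structure sgraph := SGraph {
  svertex :> finType;
  sedge : rel svertex;
  sedge_sym : symmetric sedge;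
  sedge_irr : irreflexive sedge }.

Definition giso (G H : sgraph) : Prop :=
  exists f : G -> H,
    bijective f /\ forall x y : G, sedge (f x) (f y) = sedge x y.

Section Induced.
Variables (G : sgraph) (A : {set G}).

Definition induced_edge : rel {x : G | x \in A} :=
  fun x y => sedge (val x) (val y).

Lemma induced_edge_sym : symmetric induced_edge.
Proof. by move=> x y; apply: sedge_sym. Qed.

Lemma induced_edge_irr : irreflexive induced_edge.
Proof. by move=> x; apply: sedge_irr. Qed.

Definition induced : sgraph := SGraph induced_edge_sym induced_edge_irr.
End Induced.

Definition has_induced (H F : sgraph) : Prop :=
  exists A : {set H}, giso (induced A) F.

Section Cycle.
Variable k : nat.

(* [ordS] is the successor modulo k; the guard [i != j] only matters for
   k = 1, and this is the usual cycle as soon as k >= 3. *)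
Definition cycle_edge : rel 'I_k :=
  fun i j => (i != j) && ((ordS i == j) || (ordS j == i)).

Lemma cycle_edge_sym : symmetric cycle_edge.
Proof. by move=> i j; rewrite /cycle_edge eq_sym orbC. Qed.

Lemma cycle_edge_irr : irreflexive cycle_edge.
Proof. by move=> i; rewrite /cycle_edge eqxx. Qed.

Definition cycle_graph : sgraph := SGraph cycle_edge_sym cycle_edge_irr.
End Cycle.

Section ShortestPaths.
Variables (G : sgraph) (a b : G).

(* [p] lists the vertices that follow [a], so the path has [size p] edges. *)
Definition ab_path (p : seq G) : bool :=
  [&& path (@sedge G) a p, last a p == b & uniq (a :: p)].

(* Paths have fewer than #|G| edges, so the default value #|G| is taken
   exactly when there is no path from [a] to [b]; it stands for an infinite
   distance, and no path has that length. *)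
Definition gdist : nat :=
  \big[minn/#|G|]_(n < #|G| | [exists p : n.-tuple G, ab_path p]) n.

Definition shortest_path := {p : gdist.-tuple G | ab_path p}.

(* All shortest paths start at [a] and have the same length, so they are
   compared position by position. Position i holds a vertex at distance
   i + 1 from [a], so this agrees with comparing the vertex sets. *)
Definition sp_edge : rel shortest_path :=
  fun p q => #|[set i | tnth (val p) i != tnth (val q) i]| == 1.

Lemma sp_edge_sym : symmetric sp_edge.
Proof.
move=> p q; rewrite /sp_edge; congr (_ == _).
by apply: eq_card => i; rewrite !inE eq_sym.
Qed.

Lemma sp_edge_irr : irreflexive sp_edge.
Proof.
move=> p; rewrite /sp_edge.
have -> : [set i | tnth (val p) i != tnth (val p) i] = set0.
  by apply/setP => i; rewrite !inE eqxx.
by rewrite cards0.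
Qed.

Definition sp_graph : sgraph := SGraph sp_edge_sym sp_edge_irr.
End ShortestPaths.

Definition is_sp_graph (H : sgraph) : Prop :=
  exists (G : sgraph) (a b : G), a != b /\ giso (sp_graph a b) H.

(* Main.v *)
(** Label every edge of a shortest path graph by the position in which its two
    ends differ. Two consecutive edges of an induced cycle of length greater
    than 3 have distinct labels, since otherwise there would be a chord. If
    these labels are not consecutive integers, the two changes can be made in
    either order, which gives an induced C_4. If there is no induced C_4, the
    parity of the labels therefore alternates along the cycle, so the cycle
    has even length. *)

Require Import Defs.
From mathcomp Require Import all_boot.
From mathcomp Require Import zify.

Set Implicit Arguments.
Unset Strict Implicit.
Unset Printing Implicit Defensive.

(** An embedding of [F] is easier to compose and to evaluate than a vertex set with an isomorphism.
    Conversely, the image of [f] serves as the set, and [xchoose] inverts [f] on it. *)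
Lemma has_inducedP (H F : sgraph) :
  has_induced H F <->
  exists2 f : F -> H, injective f & forall x y, sedge (f x) (f y) = sedge x y.
Proof.
split=> [[A [f [[g fK gK] fE]]]|[f f_inj fE]].
  exists (fun x => val (g x)) => [x y /val_inj/(can_inj gK)//|x y].
  by rewrite -[in RHS](gK x) -[in RHS](gK y) fE.
pose A := [set f x | x : F].
have fA x : f x \in A by apply: imset_f.
pose h (x : F) : induced A := exist _ (f x) (fA x).
have h_inj : injective h by move=> x y /(congr1 val) /f_inj.
have h_surj (y : induced A) : exists x, h x == y.
  by case: y => y yA; case/imsetP: (yA) => x _ yx; exists x; apply/eqP/val_inj.
pose g y := xchoose (h_surj y).
have gK : cancel g h by move=> y; apply/eqP/(xchooseP (h_surj y)).
have hK : cancel h g by move=> x; apply: h_inj; rewrite gK.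
exists A, g; split; first by exists h.
by move=> x y; rewrite -[in RHS](gK x) -[in RHS](gK y) -fE.
Qed.

Lemma has_induced_giso (H K F : sgraph) :
  giso H K -> (has_induced H F <-> has_induced K F).
Proof.
move=> [h [[h' hK h'K] hE]]; split=> /has_inducedP [f f_inj fE]; apply/has_inducedP.
  exists (h \o f) => [|x y /=]; last by rewrite hE fE.
  exact: inj_comp (can_inj hK) f_inj.
exists (h' \o f) => [|x y /=]; last by rewrite -hE !h'K fE.
exact: inj_comp (can_inj h'K) f_inj.
Qed.

Lemma has_induced_C4 (H : sgraph) (w x y z : H) :
  sedge w x -> sedge x y -> sedge y z -> sedge z w ->
  w != y -> x != z -> ~~ sedge w y -> ~~ sedge x z ->
  has_induced H (cycle_graph 4).
Proof.
move=> wx xy yz zw /negPf wy' /negPf xz' /negPf wy /negPf xz.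
have ne u v : sedge u v -> (u == v :> H) = false.
  by apply: contraTF => /eqP->; rewrite sedge_irr.
apply/has_inducedP; exists (fun i : 'I_4 => nth w [:: w; x; y; z] i).
  move=> i j /eqP; rewrite nth_uniq // => [/eqP/val_inj//|].
  by rewrite /= !inE (ne _ _ wx) (ne _ _ xy) (ne _ _ yz) [w == z]eq_sym (ne _ _ zw) wy' xz'.
move=> [[|[|[|[|//]]]] ?] [[|[|[|[|//]]]] ?]; rewrite /= /cycle_edge -!val_eqE /= ?sedge_irr //;
  by rewrite ?wx ?xy ?yz ?zw ?wy ?xz // sedge_sym ?wx ?xy ?yz ?zw ?wy ?xz.
Qed.

Lemma bigminn_inf (I : eqType) (r : seq I) (P : pred I) (F : I -> nat) x i :
  i \in r -> P i -> \big[minn/x]_(j <- r | P j) F j <= F i.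
Proof.
move=> + Pi; elim: r => // j r IHr; rewrite inE big_cons => /predU1P[<-|/IHr ri].
  by rewrite Pi geq_minl.
by case: ifP => // _; rewrite geq_min ri orbT.
Qed.

Section ShortestPathGraph.
Variables (G : sgraph) (a b : G).
Implicit Types p q r : shortest_path a b.

(** The vertices of a path are distinct, so its length is below [#|G|] and lies in the range of the
    minimum. *)
Lemma gdist_le s : ab_path a b s -> gdist a b <= size s.
Proof.
move=> ab_s; have /card_uniqP/= size_s : uniq (a :: s) by case/and3P: ab_s.
have lt_s : size s < #|G| by rewrite -size_s max_card.
apply: (@bigminn_inf _ _ _ _ _ (Ordinal lt_s)); first exact: mem_index_enum.
by apply/existsP; exists (in_tuple s).
Qed.

(** Shortening the walk to a path cannot lose vertices, since the path has length at least
    [gdist a b]; hence the walk repeats none. This spares a check of distinctness when a new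
    shortest path is assembled. *)
Lemma ab_path_of_walk s :
  path (@sedge G) a s -> last a s = b -> size s = gdist a b -> ab_path a b s.
Proof.
move=> path_s last_s size_s; rewrite /ab_path path_s last_s eqxx !andTb.
move: last_s; case/shortenP: path_s => s' path_s' uniq_s' sub_s' last_s'.
have /gdist_le le_s : ab_path a b s' by rewrite /ab_path path_s' last_s' eqxx.
apply: (leq_size_uniq uniq_s'); last by rewrite /= size_s ltnS.
by move=> x; rewrite !inE => /predU1P[->|/sub_s' ->]; rewrite ?eqxx ?orbT.
Qed.

Definition differ_at p q (l : 'I_(gdist a b)) :=
  forall i, (tnth (val p) i != tnth (val q) i) = (i == l).

Lemma sp_edgeP p q : reflect (exists l, differ_at p q l) (sp_edge p q).
Proof.
apply: (iffP cards1P) => [[l pq]|[l pq]]; exists l.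
  by move=> i; move/setP/(_ i): pq; rewrite !inE.
by apply/setP => i; rewrite !inE pq.
Qed.

Lemma differ_at_edge p q l : differ_at p q l -> sp_edge p q.
Proof. by move=> pq; apply/sp_edgeP; exists l. Qed.

Lemma differ_at_inj p q l m : differ_at p q l -> differ_at p q m -> l = m.
Proof. by move=> pql pqm; apply/eqP; rewrite -pqm pql. Qed.

(** Both steps change only position [l]. On the cycle this forces a coincidence or a chord whenever
    two consecutive edges share a label. *)
Lemma differ_at_trans p q r l :
  differ_at p q l -> differ_at q r l -> (p == r) || sp_edge p r.
Proof.
move=> pq qr.
have pr i : i != l -> tnth (val p) i = tnth (val r) i.
  by move=> /negPf il; move: (pq i) (qr i); rewrite il => /negbFE/eqP-> /negbFE/eqP.
have [prl|prl] := eqVneq (tnth (val p) l) (tnth (val r) l).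
  apply/orP; left; apply/eqP/val_inj/eq_from_tnth => i.
  by have [->|/pr] := eqVneq i l.
apply/orP; right; apply: (@differ_at_edge _ _ l) => i.
by have [->|/pr->] := eqVneq i l; rewrite ?eqxx.
Qed.

Lemma differ_at_two p q l m :
    tnth (val p) l != tnth (val q) l -> tnth (val p) m != tnth (val q) m ->
  l != m -> (p != q) && ~~ sp_edge p q.
Proof.
move=> pql pqm lm; apply/andP; split; first by apply: contraNneq pql => ->.
by apply/sp_edgeP => -[n pq]; move: pql pqm lm; rewrite !pq => /eqP-> /eqP->; rewrite eqxx.
Qed.

(** The path [s] makes the change at [m] without the one at [l]. As these positions are not
    consecutive, no edge of [s] meets both, so each edge of [s] is an edge of [p] or of [r]. *)
Lemma exchange_path p q r (l m : 'I_(gdist a b)) :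
  differ_at p q l -> differ_at q r m -> l.+1 != m -> m.+1 != l ->
  exists s : shortest_path a b, forall i,
    tnth (val s) i = if i == m then tnth (val r) i else tnth (val p) i.
Proof.
move=> pq qr lm ml.
pose t := [tuple if i == m then tnth (val r) i else tnth (val p) i | i < gdist a b].
have nthE (u : (gdist a b).-tuple G) (i : 'I_(gdist a b)) : nth a u i = tnth u i.
  by rewrite (tnth_nth a).
have tE (i : 'I_(gdist a b)) : nth a t i = nth a (if i == m then val r else val p) i.
  by rewrite nthE tnth_mktuple; case: ifP; rewrite nthE.
have pr (i : 'I_(gdist a b)) : i != l -> i != m -> nth a (val p) i = nth a (val r) i.
  move=> /negPf il /negPf im; rewrite !nthE.
  by move: (pq i) (qr i); rewrite il im => /negbFE/eqP-> /negbFE/eqP.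
have [/(pathP a) edge_p /eqP last_p _] := and3P (valP p).
have [/(pathP a) edge_r /eqP last_r _] := and3P (valP r).
have size_u (u : (gdist a b).-tuple G) : size u = gdist a b by rewrite size_tuple.
rewrite size_u in edge_p; rewrite size_u in edge_r.
suff ab_t : ab_path a b t.
  by exists (exist _ t ab_t) => i; rewrite tnth_mktuple.
apply: ab_path_of_walk; last exact: size_tuple.
- apply/(pathP a) => i; rewrite size_u => i_lt.
  rewrite (tE (Ordinal i_lt)) /=.
  case: i i_lt => [|i] i_lt /=.
    (* The first edge leaves [a], the common start of [p] and [r]. *)
    by case: ifP => _; [exact: edge_r 0 i_lt|exact: edge_p 0 i_lt].
  have i_lt' := ltnW i_lt; rewrite (tE (Ordinal i_lt')) /=.
  (* An edge of [s] with an end at position [m] comes from [r]: its other end is at neither [l] nor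
     [m], where [p] and [r] agree. All other edges come from [p]. *)
  have [im|im] := eqVneq (Ordinal i_lt') m.
    rewrite ifF; last by rewrite -im -val_eqE /=; lia.
    rewrite (pr (Ordinal i_lt)); first exact: edge_r i.+1 i_lt.
      by rewrite -val_eqE /=; move: ml; rewrite -im.
    by rewrite -im -val_eqE /=; lia.
  have [i1m|i1m] := eqVneq (Ordinal i_lt) m; last exact: edge_p i.+1 i_lt.
  rewrite (pr (Ordinal i_lt')) //; first exact: edge_r i.+1 i_lt.
  by rewrite -val_eqE /=; move: lm; rewrite -i1m /= eqSS eq_sym.
(* The existence of [m] makes the distance positive, so there is a last entry; it is [b] in both [p]
   and [r]. *)
- have d_lt : (gdist a b).-1 < gdist a b by rewrite ltn_predL (leq_ltn_trans _ (ltn_ord m)).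
  rewrite -nth_last size_u in last_p; rewrite -nth_last size_u in last_r.
  by rewrite -nth_last size_u (tE (Ordinal d_lt)); case: ifP.
Qed.

Lemma square_or_parity p q r (l m : 'I_(gdist a b)) :
  differ_at p q l -> differ_at q r m -> l != m ->
  has_induced (sp_graph a b) (cycle_graph 4) \/ odd m = ~~ odd l.
Proof.
move=> pq qr lm.
have [<-|lm1] := eqVneq l.+1 m; first by right.
have [<-|ml1] := eqVneq m.+1 l; first by right; rewrite negbK.
left; have [s sE] := exchange_path pq qr lm1 ml1.
have ml : (m == l) = false by rewrite eq_sym (negPf lm).
have pql := pq l; have qrm := qr m; rewrite !eqxx in pql qrm.
have /eqP qrl : tnth (val q) l == tnth (val r) l by apply: negbFE; rewrite qr (negPf lm).
have /eqP pqm : tnth (val p) m == tnth (val q) m by apply: negbFE; rewrite pq ml.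
(* The two diagonals of the square [p], [q], [r], [s] join paths that differ at both [l] and [m];
   the sides [rs] and [sp] have labels [l] and [m]. *)
have /andP[pr pr'] : (p != r) && ~~ sp_edge p r.
  by apply: (@differ_at_two _ _ l m); rewrite // -?qrl ?pqm.
have /andP[qs qs'] : (q != s) && ~~ sp_edge q s.
  by apply: (@differ_at_two _ _ l m); rewrite // sE ?(negPf lm) ?eqxx // eq_sym.
have rs : sp_edge r s.
  apply: (@differ_at_edge _ _ l) => i; rewrite sE.
  have [->|im] := eqVneq i m; first by rewrite eqxx ml.
  by rewrite -pq eq_sym; move: (qr i); rewrite (negPf im) => /negbFE/eqP->.
have sp : sp_edge s p.
  apply: (@differ_at_edge _ _ m) => i; rewrite sE.
  by have [->|im] := eqVneq i m; rewrite ?eqxx // pqm eq_sym.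
exact: (@has_induced_C4 (sp_graph a b) p q r s (differ_at_edge pq) (differ_at_edge qr)).
Qed.

End ShortestPathGraph.

Lemma val_iter_ordS k (i : 'I_k) n : val (iter n (@ordS k) i) = (i + n) %% k.
Proof.
elim: n => [|n IHn]; first by rewrite addn0 modn_small.
by rewrite iterS /= IHn -addn1 modnDml addn1 addnS.
Qed.

Lemma iter_ordS_eq k (i : 'I_k) n : (iter n (@ordS k) i == i) = (k %| n).
Proof.
rewrite -val_eqE val_iter_ordS -[X in _ == X](modn_small (ltn_ord i)).
by rewrite -[in X in _ == X](addn0 i) eqn_modDl mod0n.
Qed.

Lemma cycle_edge_ordS k (i : 'I_k) : 1 < k -> cycle_edge i (ordS i).
Proof.
move=> k_gt1; rewrite /cycle_edge eqxx andbT eq_sym.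
by rewrite (iter_ordS_eq i 1) dvdn1 neq_ltn k_gt1 orbT.
Qed.

(** Adjacency would make [k] divide 1 or 3, according to the direction of the edge. *)
Lemma cycle_edge_ordS2 k (i : 'I_k) : 3 < k -> ~~ cycle_edge i (ordS (ordS i)).
Proof.
move=> k_gt3; rewrite /cycle_edge negb_and negb_or; apply/orP; right.
rewrite eq_sym (iter_ordS_eq (ordS i) 1) (iter_ordS_eq i 3).
by apply/andP; split; apply/negP => /dvdn_leq; lia.
Qed.

Theorem lemma17 (H : sgraph) (k : nat) (Hsp : is_sp_graph H)
    (k_odd : odd k) (k_gt3 : 3 < k) (Hk : has_induced H (cycle_graph k)) :
  has_induced H (cycle_graph 4).
Proof.
case: Hsp => [G [a [b [_ isoH]]]].
apply/(has_induced_giso _ isoH).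
have /has_inducedP[c c_inj cE] := proj2 (has_induced_giso _ isoH) Hk.
have k_gt0 : 0 < k by apply: leq_trans k_gt3.
(* Indexing the cycle by all naturals allows an induction that runs once around it and closes up at
   [k]. *)
pose v n := iter n (@ordS k) (Ordinal k_gt0); pose u n := c (v n).
have uE m n : sp_edge (u m) (u n) = cycle_edge (v m) (v n) by exact: cE.
have u_edge n : sp_edge (u n) (u n.+1).
  by rewrite uE; apply/cycle_edge_ordS/(leq_trans _ k_gt3).
have u_nedge n : ~~ ((u n == u n.+2) || sp_edge (u n) (u n.+2)).
  rewrite negb_or (inj_eq c_inj) uE cycle_edge_ordS2 // andbT eq_sym.
  by rewrite (iter_ordS_eq (v n) 2); apply/negP => /dvdn_leq; lia.
have /sp_edgeP[l0 ul0] := u_edge 0.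
(* Unless an induced C_4 appears, the parity of the label flips at each step, starting from [l0]. *)
have alternate n : has_induced (sp_graph a b) (cycle_graph 4) \/
    exists2 l, differ_at (u n) (u n.+1) l & odd l = odd n (+) odd l0.
  elim: n => [|n [IHn|[l ul lE]]]; [by right; exists l0|by left|].
  have /sp_edgeP[m um] := u_edge n.+1.
  have lm : l != m.
    by apply: contraNneq (u_nedge n) => lm; apply: (differ_at_trans ul); rewrite lm.
  have [|mE] := square_or_parity ul um lm; first by left.
  by right; exists m => //; rewrite mE lE /= addNb.
(* After [k] steps the edge is again the first one, with label [l0], but an odd number of flips
   would give it the opposite parity. *)
have [//|[l ul lE]] := alternate k.
have vk : v k = v 0 by apply/eqP; rewrite iter_ordS_eq.
have uk : u k = u 0 by rewrite /u vk.
have uk1 : u k.+1 = u 1 by congr (c (ordS _)).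
rewrite uk uk1 in ul.
by move: lE; rewrite (differ_at_inj ul ul0) k_odd; case: (odd l0).
Qed.
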